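(* Let $X$ be a weighted graph as in the context, $M\in\{A,L\}$, let $T=\{u,v\}$ be a set of twins in $X$, let $\theta$ be as in the context, and suppose $\sigma_u(M)=\{\theta,\lambda_1,\ldots,\lambda_r\}$. Then pretty good state transfer occurs between $u$ and $v$ if and only if both of the following hold. (1) $u$ and $v$ are strongly cospectral with $\sigma_u^+(M)=\{\lambda_1,\ldots,\lambda_r\}$ and $\sigma_u^-(M)=\{\theta\}$. (2) For all integers $\ell_1,\ldots,\ell_r$: (a) if $\theta\neq0$, then $\frac1\theta\sum_{j=1}^r\ell_j\lambda_j$ being an odd integer implies $\sum_{j=1}^r\ell_j\left(1-\frac{\lambda_j}{\theta}\right)\neq0$; (b) if $\theta=0$, then $\sum_{j=1}^r\ell_j\lambda_j=0$ implies that $\sum_{j=1}^r\ell_j$ is even.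
   Context: $X$ is a connected weighted undirected graph (finite vertex set, no multiple edges, loops allowed, all edge/loop weights nonzero reals); $A$ is the weighted adjacency matrix, $D$ the diagonal degree matrix with $\deg(u)=2\omega_{u,u}+\sum_j\omega_{u,j}$, $L=D-A$; $U(t)=e^{itM}$. Distinct vertices $u,v$ are twins if they have the same neighbours outside $\{u,v\}$, edges from $u$ and $v$ to each common neighbour have equal weights, and their loops have equal weight (zero if absent); for $T=\{u,v\}$, $\omega$ is the common loop weight (0 if none) and $\eta$ the weight of edge $uv$ (0 if non-adjacent). $\theta=\omega-\eta$ if $M=A$ and $\theta=\deg(u)-\omega+\eta$ if $M=L$. With spectral decomposition $M=\sum_j\lambda_jE_j$, $\sigma_u(M)=\{\lambda_j:E_j\mathbf e_u\ne\mathbf 0\}$; $u,v$ strongly cospectral means $E_j\mathbf e_u=\pm E_j\mathbf e_v$ for all $j$, with $\sigma_u^{+}(M)$ (resp. $\sigma_u^-(M)$) the eigenvalues in $\sigma_u(M)$ with $E_j\mathbf e_u=E_j\mathbf e_v$ (resp. $=-E_j\mathbf e_v$). Pretty good state transfer between $u,v$: for every $\epsilon>0$ there is $\tau$ with $|U(\tau)_{u,v}|^2>1-\epsilon$. *)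

(* Defs.v *)
From HB Require Import structures.
From mathcomp Require Import all_boot all_order all_algebra.
From mathcomp Require Import complex.
From mathcomp Require Import all_classical all_reals all_analysis.
Import Order.TTheory GRing.Theory Num.Theory.
Import numFieldNormedType.Exports.

Set Implicit Arguments.
Unset Strict Implicit.
Unset Printing Implicit Defensive.

Local Open Scope ring_scope.
Local Open Scope classical_set_scope.
Local Open Scope complex_scope.

(* An undirected weighted graph on the vertex set 'I_n. Edge and loop weights
   are nonzero, so weight 0 encodes the absence of an edge or loop. *)
Record wgraph (R : realType) (n : nat) := WGraph {
  weight :> 'I_n -> 'I_n -> R;
  weight_sym : forall x y, weight x y = weight y x
}.

Section WeightedGraph.
Context {R : realType} {n : nat}.
Implicit Types (X : wgraph R n) (x y u v : 'I_n).

Definition adjacent X : rel 'I_n := [rel x y | weight X x y != 0].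

Definition connected_graph X : Prop := forall x y, connect (adjacent X) x y.

(* The sum runs over all vertices, including x itself. *)
Definition deg X x : R := 2 * weight X x x + \sum_y weight X x y.

Definition adj_mx X : 'M[R]_n := \matrix_(x, y) weight X x y.

Definition deg_mx X : 'M[R]_n := diag_mx (\row_x deg X x).

Definition lap_mx X : 'M[R]_n := deg_mx X - adj_mx X.

Definition twins X u v : Prop :=
  [/\ u != v,
      forall x, x != u -> x != v -> adjacent X u x = adjacent X v x,
      forall x, x != u -> x != v -> adjacent X u x -> adjacent X v x ->
        weight X u x = weight X v x
    & weight X u u = weight X v v].

Inductive graph_matrix := Adjacency | Laplacian.

Definition mx_of X (k : graph_matrix) : 'M[R]_n :=
  match k with Adjacency => adj_mx X | Laplacian => lap_mx X end.

Definition theta X (k : graph_matrix) u v : R :=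
  match k with
  | Adjacency => weight X u u - weight X u v
  | Laplacian => deg X u - weight X u u + weight X u v
  end.

End WeightedGraph.

Definition expmx {K : numFieldType} {n : nat} (A : 'M[K]_n) : 'M[K]_n :=
  limn (series (fun k : nat => (k`!%:R)^-1 *: A ^+ k)).

Section RealSymmetricMatrix.
Context {R : realType} {n : nat}.
Implicit Types (M : 'M[R]_n) (a t : R) (u v : 'I_n).

Definition complexify M : 'M[R[i]]_n := map_mx (real_complex R) M.

Definition transition M t : 'M[R[i]]_n := expmx (('i * t%:C) *: complexify M).

(* [eigenspace] and [proj_ortho] act on row vectors; for symmetric M the
   projection is a symmetric matrix, so it may be applied to columns as well. *)
Definition eigenproj M a : 'M[R[i]]_n :=
  proj_ortho (eigenspace (complexify M) a%:C).

Definition unit_vec u : 'cV[R[i]]_n := delta_mx u 0.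

Definition eig_support M u : set R :=
  [set a | eigenvalue M a /\ eigenproj M a *m unit_vec u <> 0].

Definition strongly_cospectral M u v : Prop :=
  forall a, eigenvalue M a ->
    eigenproj M a *m unit_vec u = eigenproj M a *m unit_vec v \/
    eigenproj M a *m unit_vec u = - (eigenproj M a *m unit_vec v).

Definition eig_support_plus M u v : set R :=
  [set a | eig_support M u a /\
           eigenproj M a *m unit_vec u = eigenproj M a *m unit_vec v].

Definition eig_support_minus M u v : set R :=
  [set a | eig_support M u a /\
           eigenproj M a *m unit_vec u = - (eigenproj M a *m unit_vec v)].

Definition pretty_good_state_transfer M u v : Prop :=
  forall eps : R, 0 < eps ->
    exists tau : R, (1 - eps)%:C < `|transition M tau u v| ^+ 2.

End RealSymmetricMatrix.

(* Main.v *)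
(** Diagonalize [M = P^* diag(d) P] with [P] unitary and let [p], [q] be the
    columns of [P] at [u] and [v].  As [e_u - e_v] is an eigenvector for [theta],
    [p] and [q] agree off the eigenvalue [theta], so the transition amplitude is
    [sum_j c_j (e^{i t lambda_j} - e^{i t theta})], where [c_j > 0] is the squared
    norm of the projection of [e_u] on the eigenspace of [lambda_j].  Expanding
    the norm of [p + q] on the eigenspace of [theta] gives [sum_j c_j <= 1/2], with
    equality iff [p = -q] there, which is condition (1); transfer forces equality.
    Then transfer means that all [e^{i t (lambda_j - theta)}] come simultaneously
    close to [-1], and a Kronecker-type theorem, proved by Bohr's method of
    expanding powers of the amplitude, turns this into: every integer relation
    [sum_j l_j (lambda_j - theta) = 0] has [sum_j l_j] even, which is (2). *)
Require Import Defs.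
From HB Require Import structures.
From mathcomp Require Import all_boot all_order all_algebra.
From mathcomp Require Import complex.
From mathcomp Require Import all_classical all_reals all_analysis.
From mathcomp Require Import ring lra zify.
Import Order.TTheory GRing.Theory Num.Theory.
Import numFieldNormedType.Exports.
Set Implicit Arguments.
Unset Strict Implicit.
Unset Printing Implicit Defensive.
Local Open Scope complex_scope.
Local Open Scope sesquilinear_scope.
Local Open Scope classical_set_scope.
Local Open Scope ring_scope.

(** * Points of the unit circle and the exponential series *)

Section UnitComplex.
Context {R : realType}.
Implicit Types (x y t : R) (z : R[i]).

(* The topology lives on the sort of a [numFieldType], not on [R[i]] itself. *)
Local Notation C := (Num.NumField.sort (R[i] : numFieldType)).

Definition cexp x : R[i] := cos x +i* sin x.

Lemma cexp0 : cexp 0 = 1.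
Proof. by rewrite /cexp cos0 sin0. Qed.

Lemma cexppi : cexp pi = -1.
Proof. by rewrite /cexp cospi sinpi; apply/eqP; rewrite eq_complex /= oppr0 !eqxx. Qed.

Lemma cexpD x y : cexp (x + y) = cexp x * cexp y.
Proof.
by rewrite /cexp cosD sinD; apply/eqP; rewrite eq_complex /= eqxx addrC eqxx.
Qed.

Lemma norm_cexp x : `|cexp x| = 1.
Proof. by rewrite normc_def /= cos2Dsin2 sqrtr1. Qed.

Lemma cexp_neq0 x : cexp x != 0.
Proof. by rewrite -normr_eq0 norm_cexp oner_eq0. Qed.

Lemma cexpN x : cexp (- x) = (cexp x)^-1.
Proof.
by apply: (mulfI (cexp_neq0 x)); rewrite -cexpD subrr cexp0 divff ?cexp_neq0.
Qed.

Lemma cexpMz x (l : int) : cexp (l%:~R * x) = cexp x ^ l.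
Proof.
have cexpMn k : cexp (k%:R * x) = cexp x ^+ k.
  elim: k => [|k IH]; first by rewrite mul0r cexp0 expr0.
  by rewrite -natr1 mulrDl mul1r cexpD IH exprSr.
case: l => k; first by rewrite -pmulrn cexpMn.
by rewrite NegzE mulrNz mulNr cexpN -pmulrn cexpMn exprnN.
Qed.

Lemma cexp_sum (I : Type) (r : seq I) (P : pred I) (F : I -> R) :
  cexp (\sum_(i <- r | P i) F i) = \prod_(i <- r | P i) cexp (F i).
Proof. by apply: (big_morph cexp); [exact: cexpD | exact: cexp0]. Qed.

Lemma norm_real_complexD (x y : R) : `|x%:C + 'i * y%:C| <= `|x|%:C + `|y|%:C :> R[i].
Proof.
apply: le_trans (ler_normD _ _) _; rewrite normrM -complexiE.
by rewrite !normc_def /= !expr0n /= !expr1n !addr0 !add0r sqrtr1 mul1r !sqrtr_sqr.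
Qed.

Lemma cvg_complex (a b : nat -> R) x y : a @ \oo --> x -> b @ \oo --> y ->
  (fun k => (a k)%:C + 'i * (b k)%:C : C) @ \oo --> (x%:C + 'i * y%:C : C).
Proof.
move=> /cvgrPdist_lt ax /cvgrPdist_lt bY; apply/cvgrPdist_lt => e e0.
have eE : e = (complex.Re e)%:C by rewrite RRe_real ?gtr0_real.
have e20 : 0 < complex.Re e / 2 by rewrite divr_gt0 // -ltcR -eE.
near=> k.
have -> : x%:C + 'i * y%:C - ((a k)%:C + 'i * (b k)%:C) =
  (x - a k)%:C + 'i * (y - b k)%:C :> R[i] by rewrite !rmorphB /=; ring.
apply: le_lt_trans (norm_real_complexD _ _) _.
rewrite eE -rmorphD /= ltcR [complex.Re e]splitr ltrD //.
  by near: k; exact: ax.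
by near: k; exact: bY.
Unshelve. all: by end_near. Qed.

(** Since ['i ^+ 2 = -1], splitting [k] by parity makes one of the two coefficients vanish and the
    other carry the right sign. *)
Lemma cexp_coeffE x k :
  (k`!%:R)^-1 * ('i * x%:C) ^+ k = (cos_coeff x k)%:C + 'i * (sin_coeff x k)%:C :> R[i].
Proof.
rewrite cos_coeffE sin_coeffE exprMn.
have [m [-> | ->]] : exists m, k = m.*2 \/ k = m.*2.+1.
  by exists k./2; rewrite -{1 3}(odd_double_half k); case: odd; [right | left].
all: rewrite ?oddS odd_double /= ?doubleK ?uphalf_double !mul0r
  ?exprS -!mul2n !exprM sqrCi.
all: rewrite !rmorphM /= !fmorphV !rmorphXn /= !rmorphN1 !rmorph_nat rmorph0.
all: ring.
Qed.

Lemma cvg_cexp x :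
  (fun m => \sum_(0 <= k < m) (k`!%:R)^-1 * ('i * x%:C) ^+ k : C) @ \oo --> (cexp x : C).
Proof.
have -> : cexp x = (cos x)%:C + 'i * (sin x)%:C.
  by rewrite -complexiE [LHS]complexE.
rewrite cos.unlock sin.unlock.
have := cvg_complex (@is_cvg_series_cos_coeff _ x) (@is_cvg_series_sin_coeff _ x).
set G := fun m => _ + _; set F := fun m => \sum_(_ <= _ < _) _; suff -> : F = G by [].
apply/funext => m.
rewrite /F /G /series /= !rmorph_sum mulr_sumr -big_split /=.
by apply: eq_bigr => k _; rewrite cexp_coeffE.
Qed.

End UnitComplex.

(** * Matrix limits and functional calculus in a unitary eigenbasis *)

Lemma cvg_mx (K : numFieldType) m n (F : nat -> 'M[K]_(m, n)) (A : 'M[K]_(m, n)) :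
  (forall i j, (fun k => F k i j) @ \oo --> A i j) -> F @ \oo --> A.
Proof.
move=> FA; apply/cvg_ballP => e e0.
have : \forall k \near \oo, forall ij : 'I_m * 'I_n, ball (A ij.1 ij.2) e (F k ij.1 ij.2).
  by apply: filter_forall => -[i j]; move/cvg_ballP: (FA i j); apply.
by apply: filterS => k FAk; split=> // i j; exact: (FAk (i, j)).
Qed.

Section UnitaryDiagonal.
Context {C : numClosedFieldType} {n : nat}.
Variable P : 'M[C]_n.
Hypothesis P_unitary : P \is unitarymx.
Implicit Types (f g : 'I_n -> C) (a c : C).

(** If [A = udiag d], then [udiag (g \o d)] is [g(A)]: functional calculus in a fixed eigenbasis. *)
Definition udiag f : 'M[C]_n := P^t* *m diag_mx (\row_k f k) *m P.

Lemma udiagE f x y : udiag f x y = \sum_k (P k x)^* * f k * P k y.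
Proof. by rewrite mxE; apply: eq_bigr => k _; rewrite mul_mx_diag !mxE. Qed.

Lemma udiagM f g : udiag f *m udiag g = udiag (fun k => f k * g k).
Proof.
rewrite /udiag -!mulmxA (mulmxA P) (unitarymxP P_unitary) mul1mx.
rewrite (mulmxA (diag_mx _)) mulmx_diag !mulmxA; congr (_ *m diag_mx _ *m _).
by apply/rowP => k; rewrite !mxE.
Qed.

Lemma mul_udiag f : P *m udiag f = diag_mx (\row_k f k) *m P.
Proof. by rewrite /udiag !mulmxA (unitarymxP P_unitary) mul1mx. Qed.

Lemma mul_udiag_col f (z : 'cV[C]_n) k : (P *m (udiag f *m z)) k 0 = f k * (P *m z) k 0.
Proof. by rewrite mulmxA mul_udiag -mulmxA mul_diag_mx !mxE. Qed.

Lemma mul_udiag_row f k : row k P *m udiag f = f k *: row k P.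
Proof. by rewrite -row_mul mul_udiag; apply/rowP => x; rewrite mxE mul_diag_mx !mxE. Qed.

Lemma row_unitary_neq0 k : row k P != 0.
Proof.
apply/eqP => Pk0; have := congr1 (row k) (unitarymxP P_unitary).
rewrite row_mul Pk0 mul0mx => /rowP/(_ k)/eqP.
by rewrite !mxE eqxx eq_sym oner_eq0.
Qed.

Lemma udiag1 : udiag (fun=> 1) = 1%:M.
Proof.
have <- : P^t* *m P = 1%:M.
  by have := mulmxKtV 1%:M P_unitary erefl; rewrite mul1mx.
rewrite /udiag; have -> : \row_(k < n) 1 = const_mx 1 :> 'rV[C]_n.
  by apply/rowP => k; rewrite !mxE.
by rewrite diag_const_mx mulmx1.
Qed.

Lemma sum_conj_mul x y : \sum_k (P k x)^* * P k y = (x == y)%:R.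
Proof.
have := congr1 (fun A : 'M[C]_n => A x y) udiag1.
by rewrite udiagE mxE => <-; apply: eq_bigr => k _; rewrite mulr1.
Qed.

Lemma udiagZ c f : c *: udiag f = udiag (fun k => c * f k).
Proof.
apply/matrixP => x y; rewrite mxE !udiagE mulr_sumr.
by apply: eq_bigr => k _; ring.
Qed.

Lemma udiagB f g : udiag f - udiag g = udiag (fun k => f k - g k).
Proof.
apply/matrixP => x y; rewrite mxE [X in _ + X]mxE !udiagE -sumrB.
by apply: eq_bigr => k _; ring.
Qed.

Lemma udiag_adj f : (udiag f)^t* = udiag (fun k => (f k)^*).
Proof.
apply/matrixP => x y; rewrite mxE [X in X^*]mxE !udiagE rmorph_sum.
by apply: eq_bigr => k _; rewrite !rmorphM /= conjCK mulrC mulrA [LHS]mulrAC.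
Qed.

Lemma udiagX f m : udiag f ^+ m = udiag (fun k => f k ^+ m).
Proof.
elim: m => [|m IH]; first by rewrite expr0 -[LHS]/(1%:M) -udiag1.
rewrite exprS IH -[LHS]/(_ *m _) udiagM.
by congr udiag; apply/funext => k; rewrite exprS.
Qed.

(** Partial sums of the matrix series are [udiag] of the scalar partial sums, so each entry is a
    finite combination of convergent scalar series. *)
Lemma expmx_udiag f g :
  (forall k, (fun m => \sum_(0 <= i < m) (i`!%:R)^-1 * f k ^+ i) @ \oo --> g k) ->
  expmx (udiag f) = udiag g.
Proof.
move=> fg; apply: cvg_lim; first exact: norm_hausdorff.
apply: cvg_mx => x y.
rewrite udiagE.
have -> : (fun m : nat => series (fun i : nat => (i`!%:R)^-1 *: udiag f ^+ i) m x y)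
 = (fun m => \sum_k (P k x)^* * (\sum_(0 <= i < m) (i`!%:R)^-1 * f k ^+ i) * P k y).
  apply/funext => m; rewrite /series /= summxE.
  transitivity (\sum_(0 <= i < m) \sum_k
      (i`!%:R)^-1 * ((P k x)^* * f k ^+ i * P k y)).
    apply: eq_bigr => i _; rewrite mxE -mulr_sumr -(udiagE (fun k => f k ^+ i)).
    by congr (_ * _); exact: (congr1 (fun A : 'M[C]_n => A x y) (udiagX f i)).
  rewrite exchange_big /=; apply: eq_bigr => k _.
  by rewrite mulr_sumr mulr_suml; apply: eq_bigr => i _; ring.
apply: cvg_big => [|k _]; first exact: add_continuous.
by apply: cvgMl; apply: cvgMr.
Qed.

(* The function [h] inverts [f - a] off the eigenvalue [a], so [1 - F] is a
   multiple of [udiag f - a] and kills the eigenspace. *)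
Lemma proj_ortho_eigenspace_udiag f a : (forall k, f k \is Num.real) ->
  proj_ortho (eigenspace (udiag f) a) = udiag (fun k => (f k == a)%:R).
Proof.
move=> f_real; set F := udiag (fun k => (f k == a)%:R);
set U := eigenspace _ _; set E := proj_ortho _.
(* The rows of [F] lie in the eigenspace, so the projection fixes them; the rows of [1 - F] turn out
   orthogonal to it. *)
have EF : F *m E = F.
  apply: proj_ortho_id; apply/eigenspaceP; rewrite udiagM udiagZ.
  congr udiag; apply/funext => k.
  by have [->|] := eqVneq (f k) a; rewrite ?mul1r ?mulr1 ?mul0r ?mulr0.
have : (1%:M - F) *m E = 0.
  apply: proj_ortho_0; apply/orthomx1P.
  have UM : U *m udiag f = a *: U by exact/eigenspaceP.
  rewrite -udiag1 udiagB.
  pose h k := if f k == a then 0 else (f k - a)^-1.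
  have FE : udiag (fun k => 1 - (f k == a)%:R) = (udiag f - a%:M) *m udiag h.
    rewrite -[a%:M]mulmx1 mul_scalar_mx -udiag1 udiagZ udiagB udiagM.
    congr udiag; apply/funext => k; rewrite /h mulr1.
    have [->|fka] := eqVneq (f k) a; rewrite ?subrr ?mulr0 // subr0 divff //.
    by rewrite subr_eq0.
  have UF : U *m udiag (fun k => 1 - (f k == a)%:R) = 0.
    by rewrite FE mulmxA mulmxBr UM mul_mx_scalar subrr mul0mx.
  (* Orthogonality involves the adjoint of [1 - F], which equals [1 - F] because its diagonal is
     real. *)
  rewrite -[LHS]trmxCK trmx_mul map_mxM trmxCK udiag_adj.
  under [in X in _ *m udiag X]eq_fun do rewrite rmorphB rmorph1 rmorph_nat.
  by rewrite UF trmx0 map_mx0.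
by rewrite mulmxBl mul1mx EF => /eqP; rewrite subr_eq0 => /eqP.
Qed.

End UnitaryDiagonal.

Lemma hermsymmx_udiag {C : numClosedFieldType} {n : nat} (A : 'M[C]_n) :
  A \is hermsymmx -> A = udiag (spectralmx A) (fun k => spectral_diag A 0 k).
Proof.
move=> /hermitian_normalmx /orthomx_spectralP {1}->.
rewrite invmx_unitary ?spectral_unitarymx // /udiag.
by congr (_ *m diag_mx _ *m _); apply/rowP => k; rewrite mxE.
Qed.

(** * Exponential sums of nearly maximal modulus *)

Section ExponentialSums.
Context {R : realType}.
Implicit Types (x y t b : R) (z : R[i]).

(* Averaging [g t] with [cexp (- w0 * h) * g (t + h)], where
   [h = pi / (x - w0)], keeps the bound and the frequency [w0] but kills the
   frequency [x]; all frequencies other than [w0] are removed this way. *)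
Lemma coef_exp_sum_le (J : finType) (a : J -> R[i]) (w : J -> R) (w0 : R) (B : R[i]) :
  (forall t, `|\sum_j a j * cexp (t * w j)| <= B) ->
  `|\sum_(j | w j == w0) a j| <= B.
Proof.
(* The induction runs over a list containing every unwanted frequency whose coefficient is still
   nonzero. *)
have : forall j, w j != w0 -> a j != 0 -> w j \in [seq w i | i : J].
  by move=> j _ _; apply/mapP; exists j; rewrite ?mem_enum.
elim: [seq w i | i : J] a => [|x s IH] a a_supp a_le.
  move: (a_le 0); rewrite (bigID (fun j => w j == w0)) /= [X in _ + X]big1.
    by rewrite addr0; under eq_bigr do rewrite mul0r cexp0 mulr1.
  move=> j wj; apply/eqP; rewrite mulf_eq0; apply/orP; left.
  by apply/negPn/negP => aj; have := a_supp j wj aj.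
have [xw0|xw0] := eqVneq x w0.
  apply: IH => // j wj aj; have := a_supp j wj aj.
  by rewrite inE xw0 (negbTE wj).
pose h := pi / (x - w0).
have xw0' : x - w0 != 0 by rewrite subr_eq0.
pose a' j := a j * ((1 + cexp ((w j - w0) * h)) / 2).
have -> : \sum_(j | w j == w0) a j = \sum_(j | w j == w0) a' j.
  apply: eq_bigr => j /eqP wj; rewrite /a' wj subrr mul0r cexp0.
  by rewrite -[1 + 1]/(2%:R) divff ?pnatr_eq0 // mulr1.
apply: IH => [j wj|t].
  rewrite /a' mulf_eq0 negb_or => /andP[aj].
  have := a_supp j wj aj; rewrite inE => /orP[/eqP -> | //].
  by rewrite /h mulrCA divff // mulr1 cexppi subrr mul0r eqxx.
have -> : \sum_j a' j * cexp (t * w j) =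
    (\sum_j a j * cexp (t * w j) +
     cexp (- w0 * h) * \sum_j a j * cexp ((t + h) * w j)) / 2.
  rewrite mulr_sumr -big_split /= mulr_suml; apply: eq_bigr => j _.
  rewrite /a' (_ : (w j - w0) * h = - w0 * h + h * w j); last by ring.
  by rewrite !mulrDl !cexpD; ring.
rewrite normrM normfV (ger0_norm (ler0n _ _)) ler_pdivrMr ?ltr0n //.
rewrite mulr_natr mulr2n.
apply: le_trans (ler_normD _ _) _.
by rewrite lerD // normrM norm_cexp mul1r.
Qed.

Lemma bernoulli_le x m : 0 <= x -> 1 + m%:R * x <= (1 + x) ^+ m.
Proof.
move=> x0; elim: m => [|m IH]; first by rewrite mul0r addr0 expr0.
rewrite exprS.
have x1 : 0 <= 1 + x by rewrite addr_ge0.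
apply: le_trans (ler_wpM2l x1 IH).
have : 0 <= x * x * m%:R by rewrite !mulr_ge0.
rewrite -natr1; nra.
Qed.

(** Exponential decay beats polynomial growth; Bernoulli's inequality for [b^-1 = 1 + x] gives an
    explicit exponent. *)
Lemma poly_exp_lt1 b D : 0 <= b -> b < 1 -> exists p, p.+1%:R ^+ D * b ^+ p < 1.
Proof.
move=> b0 b1; have [->|b_neq0] := eqVneq b 0.
  by exists 1; rewrite expr1 mulr0.
have {b0 b_neq0} b0 : 0 < b by rewrite lt_def b_neq0.
pose x := b^-1 - 1.
have x0 : 0 < x by rewrite subr_gt0 invf_gt1.
have bE : b^-1 = 1 + x by rewrite /x; ring.
(* Chosen so that [y < k + 1] means [(D+2)^D < (k+1) x^(D+1)]. With [p = (k+1)(D+1)] this yields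
   [(p+1)^D <= ((k+1)(D+2))^D < ((k+1)x)^(D+1) <= (1+x)^p]. *)
pose y := (D.+2%:R ^+ D) / x ^+ D.+1 : R.
have y0 : 0 <= y by rewrite divr_ge0 ?exprn_ge0 // ltW.
have [k] : exists k : nat, y < k.+1%:R.
  exists (Num.bound y); apply: lt_trans (archi_boundP y0) _.
  by rewrite ltr_nat.
rewrite ltr_pdivrMr ?exprn_gt0 // => kx.
exists (k.+1 * D.+1)%N.
rewrite -ltr_pdivlMr ?exprn_gt0 // mul1r -exprVn bE exprM.
have pk : (k.+1 * D.+1).+1%:R <= k.+1%:R * D.+2%:R :> R.
  by rewrite -natrM ler_nat [(_ * D.+2)%N]mulnS addnC -addn1 leq_add2l.
apply: (@le_lt_trans _ _ ((k.+1%:R * D.+2%:R) ^+ D)).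
  by rewrite lerXn2r ?nnegrE ?mulr_ge0.
apply: (@lt_le_trans _ _ ((k.+1%:R * x) ^+ D.+1)).
  by rewrite !exprMn exprS -mulrA mulrCA ltr_pM2l ?exprn_gt0.
have kx_le : k.+1%:R * x <= (1 + x) ^+ k.+1.
  by apply: le_trans (bernoulli_le k.+1 (ltW x0)); rewrite lerDr.
have kx_ge0 : 0 <= k.+1%:R * x by rewrite mulr_ge0 // ltW.
by rewrite lerXn2r ?nnegrE // (le_trans kx_ge0).
Qed.

(* Bohr's argument: if the modulus stayed below [b < 1], then the coefficients
   of the [p]-th power of the sum would be at most [b ^ p]; merging equal frequencies
   involves no cancellation, so the at most [(p + 1) ^ #|I|] coefficients have
   moduli summing to [1]. *)
Lemma exp_sum_dense (I : finType) (w nu : I -> R) (s : I -> bool) b :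
  (forall i, 0 <= w i) -> \sum_i w i = 1 -> b < 1 ->
  (forall m m' : I -> nat, (\sum_i m i = \sum_i m' i)%N ->
    \sum_i (m i)%:R * nu i = \sum_i (m' i)%:R * nu i ->
    odd (\sum_i m i * s i) = odd (\sum_i m' i * s i)) ->
  exists t, b%:C < `|\sum_i (w i)%:C * (-1) ^+ s i * cexp (t * nu i)|.
Proof.
move=> w0 w1 b1 parity; apply: contrapT => not_dense.
pose G t : R[i] := \sum_i (w i)%:C * (-1) ^+ s i * cexp (t * nu i).
have G_le t : `|G t| <= b%:C.
  rewrite real_leNgt ?normr_real ?complex_real //.
  by apply/negP => Gt; apply: not_dense; exists t.
have b0 : 0 <= b by rewrite -lecR (le_trans (normr_ge0 _) (G_le 0)).
have [p] := poly_exp_lt1 #|I| b0 b1; apply/negP; rewrite -leNgt.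
(* The [p]-th power expands over words [f] of length [p]; [mult f i] counts the letter [i]. *)
pose mult (f : {ffun 'I_p -> I}) i : nat := (\sum_k (f k == i))%N.
pose W (f : {ffun 'I_p -> I}) : R := \prod_k w (f k).
have W0 f : 0 <= W f by apply: prodr_ge0.
have multE (V : nmodType) (F : I -> V) (f : {ffun 'I_p -> I}) :
    \sum_k F (f k) = \sum_i F i *+ mult f i.
  under [RHS]eq_bigr do rewrite /mult -sumrMnr.
  rewrite exchange_big /=; apply: eq_bigr => k _.
  rewrite (bigD1 (f k)) //= eqxx mulr1n big1 ?addr0 // => i ik.
  by rewrite eq_sym (negbTE ik).
have multR (F : I -> R) (f : {ffun 'I_p -> I}) :
    \sum_k F (f k) = \sum_i (mult f i)%:R * F i.
  by rewrite multE; apply: eq_bigr => i _; rewrite mulr_natl.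
have multN (F : I -> nat) (f : {ffun 'I_p -> I}) :
    (\sum_k F (f k) = \sum_i mult f i * F i)%N.
  by rewrite [LHS]multE; apply: eq_bigr => i _; rewrite -mulr_natl natn.
have mult_sum f : (\sum_i mult f i = p)%N.
  have := multN (fun=> 1%N) f; rewrite sum1_card card_ord => ->.
  by apply: eq_bigr => i _; rewrite muln1.
pose Om (f : {ffun 'I_p -> I}) : R := \sum_k nu (f k).
pose sg (f : {ffun 'I_p -> I}) : nat := (\sum_k s (f k))%N.
have GX t : G t ^+ p = \sum_f ((W f)%:C * (-1) ^+ sg f) * cexp (t * Om f).
  rewrite -[in LHS](card_ord p) -prodr_const (bigA_distr_bigA (fun _ => _)) /=.
  apply: eq_bigr => f _; rewrite !big_split /= /W rmorph_prod; congr (_ * _ * _).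
    by rewrite prodrXr.
  by rewrite /Om mulr_sumr cexp_sum.
(* Words of equal frequency have equal signs by [parity], so the coefficient of a frequency has
   modulus the total weight of its words. *)
have class_le f0 : \sum_(f | Om f == Om f0) W f <= b ^+ p.
  have GX_le t : `|\sum_f ((W f)%:C * (-1) ^+ sg f) * cexp (t * Om f)| <= (b ^+ p)%:C.
    by rewrite -GX normrX rmorphXn lerXn2r ?nnegrE ?normr_ge0 ?ler0c ?G_le.
  have := coef_exp_sum_le (Om f0) GX_le.
  have -> : \sum_(f | Om f == Om f0) (W f)%:C * (-1) ^+ sg f =
      (-1) ^+ sg f0 * (\sum_(f | Om f == Om f0) W f)%:C :> R[i].
    rewrite rmorph_sum mulr_sumr; apply: eq_bigr => f /eqP Of; rewrite mulrC.
    congr (_ * _); rewrite -signr_odd -[RHS]signr_odd; congr (_ ^+ _); congr nat_of_bool.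
    by rewrite /sg !(multN (fun i => s i : nat)); apply: parity; rewrite ?mult_sum // -!multR.
  rewrite normrM normrX normrN1 expr1n mul1r ger0_norm ?ler0c ?sumr_ge0 //.
  by rewrite lecR.
(* The multiplicities are at most [p], so [inord] loses nothing, and they determine the frequency:
   each class of [cl] lies inside one frequency class. *)
pose cl (f : {ffun 'I_p -> I}) : {ffun I -> 'I_p.+1} := [ffun i => inord (mult f i)].
have cl_le c : \sum_(f | cl f == c) W f <= b ^+ p.
  have [f0 /eqP <-|no_f] := pickP (fun f => cl f == c); last first.
    by rewrite big_pred0 // exprn_ge0.
  apply: le_trans (class_le f0).
  rewrite [leRHS](bigID (fun f => cl f == cl f0)) /= ler_wpDr ?sumr_ge0 //.
  rewrite le_eqVlt; apply/orP; left; apply/eqP; apply: eq_bigl => f.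
  rewrite andb_idl // => /eqP/ffunP clf; apply/eqP; rewrite /Om !multR.
  apply: eq_bigr => i _; congr (_%:R * _).
  have mult_lt g : (mult g i < p.+1)%N.
    by rewrite ltnS -(mult_sum g) (bigD1 i) //= leq_addr.
  by have /(congr1 val) := clf i; rewrite !ffunE /= !inordK.
have W1 : \sum_f W f = 1.
  transitivity (\prod_(k < p) \sum_i w i); last by rewrite big1.
  by rewrite (bigA_distr_bigA (fun _ => w)).
rewrite -[leLHS]W1 (partition_big cl predT) //=.
apply: le_trans (ler_sum _ (fun c _ => cl_le c)) _.
by rewrite sumr_const card_ffun card_ord -natrX mulr_natl.
Qed.

End ExponentialSums.

(** * Distance to 1 of products of integer powers on the unit circle *)

Section UnitPowers.
Context {R : realType}.
Implicit Types (x y t : R).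

Lemma norm_cexpXz_sub1 x (l : int) :
  `|cexp x ^ l - 1| <= `|l|%:~R * `|cexp x - 1| :> R[i].
Proof.
have pow_le k : `|cexp x ^+ k - 1| <= k%:R * `|cexp x - 1|.
  elim: k => [|k IH]; first by rewrite expr0 subrr normr0 mul0r.
  have -> : cexp x ^+ k.+1 - 1 = cexp x * (cexp x ^+ k - 1) + (cexp x - 1).
    by rewrite exprS; ring.
  rewrite -natr1 mulrDl mul1r (le_trans (ler_normD _ _)) // lerD2r.
  by rewrite normrM norm_cexp mul1r.
case: l => k; first by rewrite -pmulrn; exact: pow_le.
rewrite NegzE -exprnN normrN -[X in X%:~R]/(k.+1%:Z) -pmulrn.
apply: le_trans (pow_le k.+1).
have -> : (cexp x ^+ k.+1)^-1 - 1 = - (cexp x ^+ k.+1)^-1 * (cexp x ^+ k.+1 - 1).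
  by rewrite mulNr mulrBr mulVf ?expf_neq0 ?cexp_neq0 //; ring.
by rewrite normrM normrN normfV normrX norm_cexp expr1n invr1 mul1r.
Qed.

Lemma norm_prod_cexp_sub1 (I : Type) (s : seq I) (x : I -> R) (l : I -> int) :
  `|\prod_(i <- s) cexp (x i) ^ l i - 1| <=
  \sum_(i <- s) `|l i|%:~R * `|cexp (x i) - 1| :> R[i].
Proof.
elim: s => [|i s IH]; first by rewrite !big_nil subrr normr0.
rewrite !big_cons; set p := \prod_(_ <- _) _.
have -> : cexp (x i) ^ l i * p - 1 = (cexp (x i) ^ l i - 1) + cexp (x i) ^ l i * (p - 1).
  by ring.
rewrite (le_trans (ler_normD _ _)) // lerD ?norm_cexpXz_sub1 //.
by rewrite normrM -cexpMz norm_cexp mul1r.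
Qed.

(** The shift by [pi] turns closeness to [-1] into closeness to [1], measured by the quantity
    [1 + cos x] that the amplitude controls. *)
Lemma normsq_cexp_sub1 x : `|cexp (x + pi) - 1| ^+ 2 = (2 * (1 + cos x))%:C :> R[i].
Proof.
rewrite -add_Re2_Im2 /= cosDpi sinDpi; congr (_%:C).
have := cos2Dsin2 x; nra.
Qed.

End UnitPowers.

(** * Near transfer and the parity of integer relations *)

Section AlmostTransfer.
Context {R : realType} {r : nat}.
Variables (c lambda : 'I_r -> R) (th : R).
Hypothesis c_gt0 : forall j, 0 < c j.
Local Notation W := (\sum_j c j).

Definition amplitude t : R[i] := \sum_j (c j)%:C * (cexp (t * lambda j) - cexp (t * th)).

Definition almost_transfer := forall eps : R, 0 < eps ->
  exists t, (1 - eps)%:C < `|amplitude t| ^+ 2.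

(** One form for both cases of condition (2); see [even_relationsP]. *)
Definition even_relations := forall l : 'I_r -> int,
  \sum_j (l j)%:~R * (lambda j - th) = 0 -> (2 %| \sum_j l j)%Z.

Lemma almost_transfer_mass_ge : almost_transfer -> 2^-1 <= W.
Proof.
move=> transfer; rewrite leNgt; apply/negP => W_lt.
have W0 : 0 <= W by apply: sumr_ge0 => j _; exact: ltW.
(* Each term of the amplitude has modulus at most [2 * c j]; this tolerance makes the threshold
   exactly [(2W)^2]. *)
have [|t] := transfer (1 - 4 * W ^+ 2); first by nra.
apply/negP; rewrite -real_leNgt ?(rpredX 2 (normr_real _)) ?complex_real //.
have amp_le : `|amplitude t| <= (2 * W)%:C.
  rewrite mulr_sumr rmorph_sum (le_trans (ler_norm_sum _ _ _)) //.
  apply: ler_sum => j _; rewrite normrM ger0_norm ?ler0c ?(ltW (c_gt0 _)) //.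
  rewrite [leRHS]rmorphM /= [leRHS]mulrC ler_wpM2l ?ler0c ?(ltW (c_gt0 _)) //.
  by rewrite (le_trans (ler_normB _ _)) // !norm_cexp rmorph_nat.
rewrite (_ : 1 - (1 - 4 * W ^+ 2) = (2 * W) ^+ 2); last by ring.
by rewrite rmorphXn /= lerXn2r ?nnegrE ?normr_ge0 // ler0c mulr_ge0.
Qed.

(* With [z j = cexp (t * (lambda j - th))] and [Z] the sum of the [c j * z j],
   the squared amplitude is [|Z - 1/2| ^ 2 <= 1/2 - Re Z]. *)
Lemma cos_close t eps : W = 2^-1 -> (1 - eps)%:C < `|amplitude t| ^+ 2 ->
  forall k, c k * (1 + cos (t * (lambda k - th))) < eps.
Proof.
move=> W12 amp_gt k.
pose x j := t * (lambda j - th).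
pose Z : R[i] := \sum_j (c j)%:C * cexp (x j).
have ampE : amplitude t = cexp (t * th) * (Z - (2^-1)%:C).
  rewrite -W12 rmorph_sum -sumrB mulr_sumr; apply: eq_bigr => j _.
  rewrite (_ : t * lambda j = t * th + x j); last by rewrite /x; ring.
  by rewrite cexpD; ring.
have ReZ : complex.Re Z = \sum_j c j * cos (x j).
  rewrite /Z (big_morph (@complex.Re R) (id1 := 0) (op1 := +%R)) //; last by case=> ? ? [].
  by apply: eq_bigr => j _ /=; rewrite mul0r subr0.
have Z_le : `|Z| <= (2^-1)%:C.
  rewrite -W12 rmorph_sum (le_trans (ler_norm_sum _ _ _)) //.
  apply: ler_sum => j _.
  by rewrite normrM norm_cexp mulr1 ger0_norm ?ler0c ?(ltW (c_gt0 _)).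
have Z2_le : (complex.Re Z) ^+ 2 + (complex.Im Z) ^+ 2 <= (2^-1) ^+ 2.
  rewrite -lecR add_Re2_Im2 rmorphXn /= lerXn2r ?nnegrE ?normr_ge0 //.
  by rewrite ler0c.
have amp2 : `|amplitude t| ^+ 2 = ((complex.Re Z - 2^-1) ^+ 2 + (complex.Im Z) ^+ 2)%:C.
  rewrite ampE normrM norm_cexp mul1r -add_Re2_Im2.
  by case: (Z) => a b /=; rewrite subr0.
(* The summands are nonnegative, so bounding their total [1/2 + Re Z] bounds each of them. *)
have : \sum_j c j * (1 + cos (x j)) < eps.
  have -> : \sum_j c j * (1 + cos (x j)) = 2^-1 + complex.Re Z.
    rewrite ReZ -W12 -big_split /=; apply: eq_bigr => j _; ring.
  by move: amp_gt; rewrite amp2 ltcR; lra.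
apply: le_lt_trans; rewrite (bigD1 k) //= ler_wpDr // sumr_ge0 // => j _.
by rewrite mulr_ge0 ?(ltW (c_gt0 _)) // -lerBlDl sub0r cos_geN1.
Qed.

(** At a time of near transfer the shifted phases are all close to 1, hence so is the product of
    their [l j]-th powers. The relation makes this product [(-1) ^ (\sum_j l j)], at distance 2 from
    1 if the sum is odd. *)
Lemma almost_transfer_even : W = 2^-1 -> almost_transfer -> even_relations.
Proof.
move=> W12 transfer l rel0; apply/negPn/negP => l_odd.
pose L : R := 1 + \sum_j `|l j|%:~R.
have L_ge1 : 1 <= L by rewrite lerDl sumr_ge0 // => j _; rewrite ler0z.
have L0 : 0 < L by apply: lt_le_trans L_ge1.
(* With [cm <= c j], the tolerance below gives [2 * (1 + cos) < L^-2]. The seed [1] keeps the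
   minimum positive. *)
pose cm : R := \big[Num.min/1]_j c j.
have cm0 : 0 < cm by apply: lt_bigmin.
have [|t amp_gt] := transfer (cm / (2 * L ^+ 2)).
  by rewrite divr_gt0 ?mulr_gt0 ?exprn_gt0.
have y_le j : `|cexp (t * (lambda j - th) + pi) - 1| <= (L^-1)%:C.
  rewrite -(@ler_pXn2r _ 2) ?nnegrE ?normr_ge0 ?ler0c ?invr_ge0 ?(ltW L0) //.
  rewrite normsq_cexp_sub1 -rmorphXn /= lecR.
  have := cos_close W12 amp_gt j.
  have cm_le : cm <= c j by exact: bigmin_le.
  set q := 1 + cos _ => cq_lt.
  have q0 : 0 <= q by rewrite -lerBlDl sub0r cos_geN1.
  have {cq_lt} : cm * q < cm / (2 * L ^+ 2).
    by apply: le_lt_trans cq_lt; rewrite ler_wpM2r.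
  rewrite ltr_pM2l // invfM exprVn; set i2 := (L ^+ 2)^-1; lra.
have : `|\prod_j cexp (t * (lambda j - th) + pi) ^ l j - 1| < 2.
  apply: le_lt_trans (norm_prod_cexp_sub1 _ _ _) _.
  apply: (@le_lt_trans _ _ (\sum_j `|l j|%:~R * (L^-1)%:C)).
    by apply: ler_sum => j _; rewrite ler_wpM2l ?ler0z.
  rewrite -mulr_suml (_ : \sum_j `|l j|%:~R = (L - 1)%:C); last first.
    by rewrite /L [1 + _]addrC addrK rmorph_sum;
      apply: eq_bigr => j _; rewrite rmorph_int.
  have -> : (L - 1)%:C * (L^-1)%:C = ((L - 1) / L)%:C :> R[i] by rewrite rmorphM.
  have -> : 2 = 2%:C :> R[i] by rewrite rmorph_nat.
  rewrite ltcR ltr_pdivrMr //; lra.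
under eq_bigr do rewrite -cexpMz.
rewrite -cexp_sum.
have -> : \sum_j (l j)%:~R * (t * (lambda j - th) + pi) = (\sum_j l j)%:~R * pi.
  transitivity (t * (\sum_j (l j)%:~R * (lambda j - th)) + (\sum_j l j)%:~R * pi).
    rewrite [X in _ + X * _]rmorph_sum mulr_sumr mulr_suml -big_split /=.
    by apply: eq_bigr => j _; ring.
  by rewrite rel0 mulr0 add0r.
rewrite cexpMz cexppi expN1r -signr_odd.
move: l_odd; rewrite dvdzE dvdn2 negbK => ->.
by rewrite expr1 -opprD normrN ger0_norm ?addr_ge0 // ltxx.
Qed.

(** The density result is applied with an extra index [ord0] for [th], of weight 1/2 and sign -1,
    which brings the total weight to 1. *)
Lemma even_almost_transfer : W = 2^-1 -> even_relations -> almost_transfer.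
Proof.
move=> W12 even_rel eps eps0.
pose ext (T : Type) (x0 : T) (f : 'I_r -> T) (i : 'I_r.+1) :=
  if unlift ord0 i is Some j then f j else x0.
have ext0 T x0 f : @ext T x0 f ord0 = x0 by rewrite /ext unlift_none.
have extS T x0 f (j : 'I_r) : @ext T x0 f (lift ord0 j) = f j by rewrite /ext liftK.
(* Here [1 - eps <= b ^+ 2]; the maximum with 0 allows squaring of inequalities. *)
pose b := Num.max 0 (1 - eps / 2).
have [| | | |t] := @exp_sum_dense R _ (ext _ (2^-1) c) (ext _ th lambda)
  (ext _ true (fun=> false)) b.
- by move=> i; rewrite /ext; case: unlift => [j|]; [exact: ltW | rewrite invr_ge0].
- rewrite big_ord_recl ext0; under eq_bigr do rewrite extS.
  by rewrite W12; lra.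
- by rewrite /b gt_max ltr01 ltrBlDr ltrDl divr_gt0.
- move=> m m'; rewrite ![(\sum_i _)%N]big_ord_recl !big_ord_recl !ext0 => sum_eq rel_eq.
  rewrite !big1; try by move=> i _; rewrite extS muln0.
  rewrite !muln1 !addn0.
  (* Equal totals make [\sum_j l j] the difference of the multiplicities of [th], and only these
     enter the sign. *)
  pose l (j : 'I_r) : int := (m (lift ord0 j))%:Z - (m' (lift ord0 j))%:Z.
  have intsum (f : 'I_r -> nat) : \sum_j (f j)%:Z = (\sum_j f j)%N%:Z.
    by rewrite (big_morph Posz PoszD (erefl 0%:Z)).
  have lsum : \sum_j l j = (m' ord0)%:Z - (m ord0)%:Z.
    rewrite sumrB !intsum; have := congr1 Posz sum_eq; rewrite !PoszD.
    set A := Posz (\sum_(i < r) m _)%N; set B := Posz (\sum_(i < r) m' _)%N; lia.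
  have : (2 %| \sum_j l j)%Z.
    apply: even_rel.
    transitivity (\sum_j (m (lift ord0 j))%:R * lambda j -
      \sum_j (m' (lift ord0 j))%:R * lambda j - (\sum_j l j)%:~R * th).
      rewrite [X in _ - X * _]rmorph_sum mulr_suml -!sumrB; apply: eq_bigr => j _.
      by rewrite /l rmorphB /=; ring.
    have relE (k : 'I_r.+1 -> nat) :
        \sum_(i < r) (k (lift ord0 i))%:R * ext R th lambda (lift ord0 i) =
        \sum_j (k (lift ord0 j))%:R * lambda j.
      by apply: eq_bigr => j _; rewrite extS.
    by move: rel_eq; rewrite !relE lsum rmorphB /= -!pmulrn; lra.
  rewrite lsum dvdzE dvdn2; lia.
rewrite big_ord_recl !ext0; under eq_bigr do rewrite !extS expr0 mulr1.
move=> amp_gt; exists t.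
have -> : amplitude t = (2^-1)%:C * (-1) ^+ true * cexp (t * th) +
    \sum_j (c j)%:C * cexp (t * lambda j).
  rewrite /amplitude; under eq_bigr do rewrite mulrBr.
  by rewrite sumrB -mulr_suml -rmorph_sum W12 expr1; ring.
have b0 : 0 <= b by rewrite le_max lexx.
apply: (@le_lt_trans _ _ ((b ^+ 2)%:C)).
  rewrite lecR /b; case: (leP 0 (1 - eps / 2)) => e2; nra.
by rewrite rmorphXn /= ltrXn2r // ?nnegrE ?normr_ge0 ?ler0c.
Qed.

End AlmostTransfer.

(** * Spectral masses of two orthonormal columns agreeing off one eigenvalue *)

Section Amplitude.
Context {R : realType} {n r : nat}.
Variables (p q : 'I_n -> R[i]) (d : 'I_n -> R) (th : R) (lambda : 'I_r -> R).

(** The squared modulus as an element of [R], since the norm on [R[i]] is [R[i]]-valued. *)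
Definition normsq (z : R[i]) : R := complex.Re z ^+ 2 + complex.Im z ^+ 2.

Lemma conj_mul_normsq (z : R[i]) : z^* * z = (normsq z)%:C.
Proof. by rewrite /normsq add_Re2_Im2 normCK mulrC. Qed.

Lemma normsq_ge0 (z : R[i]) : 0 <= normsq z.
Proof. by rewrite addr_ge0 ?sqr_ge0. Qed.

Lemma normsq_eq0 (z : R[i]) : (normsq z == 0) = (z == 0).
Proof.
by rewrite -(inj_eq (@complexI R)) /normsq add_Re2_Im2 expf_eq0 /= normr_eq0.
Qed.

Hypothesis p_unit : \sum_k (p k)^* * p k = 1.
Hypothesis q_unit : \sum_k (q k)^* * q k = 1.
Hypothesis pq_ortho : \sum_k (p k)^* * q k = 0.
Hypothesis pq_eq : forall k, d k <> th -> p k = q k.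
Hypothesis lambda_inj : injective lambda.
Hypothesis lambda_neq : forall j, lambda j <> th.
Hypothesis p_supp : forall k, p k != 0 -> d k = th \/ exists j, d k = lambda j.
Hypothesis supp_p : forall j, exists2 k, d k = lambda j & p k != 0.

Definition mass j : R := \sum_(k | d k == lambda j) normsq (p k).

Lemma mass_gt0 j : 0 < mass j.
Proof.
have [k dk pk] := supp_p j.
rewrite /mass (bigD1 k) ?dk //= ltr_wpDr ?sumr_ge0 // => [i _|]; first exact: normsq_ge0.
by rewrite lt_def normsq_eq0 pk normsq_ge0.
Qed.

(** Indices are grouped by eigenvalue: off [th], each [k] with [p k != 0] matches exactly one
    [lambda j], by injectivity. *)
Lemma sum_mass (g : R -> R[i]) :
  \sum_(k | d k != th) (normsq (p k))%:C * g (d k) = \sum_j (mass j)%:C * g (lambda j).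
Proof.
under [RHS]eq_bigr do rewrite rmorph_sum mulr_suml big_mkcond /=.
rewrite exchange_big /= big_mkcond; apply: eq_bigr => k _.
have [dk|dk] := eqVneq (d k) th.
  rewrite big1 // => j _; rewrite dk; case: eqVneq => // thj.
  by case: (lambda_neq (esym thj)).
have [pk|pk] := eqVneq (p k) 0.
  have -> : normsq (p k) = 0 by apply/eqP; rewrite normsq_eq0 pk.
  by rewrite mul0r big1 // => j _; rewrite mul0r if_same.
have [/eqP|[j dkj]] := p_supp pk; first by rewrite (negbTE dk).
rewrite (bigD1 j) //= dkj eqxx big1 ?addr0 // => i ij.
by rewrite (inj_eq lambda_inj) eq_sym (negbTE ij).
Qed.

(** By orthogonality the part at [th] cancels the rest, where [p = q] turns the overlap into
    mass. *)
Lemma sum_overlap_theta :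
  \sum_(k | d k == th) (p k)^* * q k = - (\sum_j mass j)%:C.
Proof.
have := pq_ortho; rewrite (bigID (fun k => d k == th)) /= => /eqP.
rewrite addr_eq0 => /eqP ->; congr (- _); apply: esym; rewrite rmorph_sum /=.
have := sum_mass (fun=> 1); under [X in _ = X]eq_bigr do rewrite mulr1.
move=> <-; apply: eq_bigr => k /eqP dk.
by rewrite mulr1 -conj_mul_normsq -pq_eq.
Qed.

Lemma overlap_amplitude t :
  \sum_k (p k)^* * cexp (t * d k) * q k = amplitude mass lambda th t.
Proof.
rewrite (bigID (fun k => d k == th)) /=.
have -> : \sum_(k | d k == th) (p k)^* * cexp (t * d k) * q k =
    cexp (t * th) * \sum_(k | d k == th) (p k)^* * q k.
  by rewrite mulr_sumr; apply: eq_bigr => k /eqP ->; ring.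
have -> : \sum_(k | d k != th) (p k)^* * cexp (t * d k) * q k =
    \sum_(k | d k != th) (normsq (p k))%:C * cexp (t * d k).
  apply: eq_bigr => k /eqP dk; rewrite -conj_mul_normsq -(pq_eq dk); ring.
rewrite (sum_mass (fun x => cexp (t * x))) sum_overlap_theta /amplitude.
under [RHS]eq_bigr do rewrite mulrBr.
by rewrite sumrB -mulr_suml rmorph_sum; ring.
Qed.

(** Orthonormality gives [p + q] total squared norm 2, and off [th] each index contributes
    [4 * normsq (p k)]. *)
Lemma sum_normsqD_theta :
  \sum_(k | d k == th) normsq (p k + q k) = 2 - 4 * \sum_j mass j.
Proof.
apply: (@complexI R).
have qp_ortho : \sum_k (q k)^* * p k = 0.
  transitivity ((\sum_k (p k)^* * q k)^*); last by rewrite pq_ortho rmorph0.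
  by rewrite rmorph_sum; apply: eq_bigr => k _; rewrite rmorphM /= conjCK mulrC.
have all2 : \sum_k (p k + q k)^* * (p k + q k) = 2.
  transitivity (\sum_k (p k)^* * p k + \sum_k (q k)^* * q k +
    (\sum_k (p k)^* * q k + \sum_k (q k)^* * p k)).
    by rewrite -!big_split /=; apply: eq_bigr => k _; rewrite rmorphD /=; ring.
  by rewrite p_unit q_unit pq_ortho qp_ortho !addr0.
have off : \sum_(k | d k != th) (p k + q k)^* * (p k + q k) = 4 * (\sum_j mass j)%:C.
  transitivity (\sum_(k | d k != th) (normsq (p k))%:C * 4).
    apply: eq_bigr => k /eqP dk.
    by rewrite -conj_mul_normsq -(pq_eq dk) rmorphD /=; ring.
  by rewrite (sum_mass (fun=> 4)) -mulr_suml rmorph_sum mulrC.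
move: all2; rewrite (bigID (fun k => d k == th)) /= off => all2.
rewrite rmorph_sum rmorphB rmorphM !rmorph_nat -all2.
rewrite addrK; apply: eq_bigr => k _; by rewrite conj_mul_normsq.
Qed.

Lemma mass_le : \sum_j mass j <= 2^-1.
Proof.
have := sum_normsqD_theta.
have : 0 <= \sum_(k | d k == th) normsq (p k + q k).
  by apply: sumr_ge0 => k _; exact: normsq_ge0.
lra.
Qed.

Lemma mass_halfP :
  \sum_j mass j = 2^-1 <-> (forall k, d k = th -> p k = - q k).
Proof.
have sumE := sum_normsqD_theta; split=> [W12 k dk|pNq].
  have sum0 : \sum_(k | d k == th) normsq (p k + q k) = 0 by lra.
  apply/eqP; rewrite -addr_eq0 -normsq_eq0; apply/eqP.
  by apply: (psumr_eq0P _ sum0) => [i _|]; [exact: normsq_ge0 | apply/eqP].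
move: sumE; rewrite big1 => [|k /eqP /pNq ->]; first lra.
by apply/eqP; rewrite normsq_eq0 addNr.
Qed.

End Amplitude.

(** * Spectral data of a real symmetric matrix in coordinates *)

Section SymmetricMatrix.
Context {R : realType} {n : nat} (M : 'M[R]_n).

Lemma symmetric_udiag : M^T = M -> exists (P : 'M[R[i]]_n) (d : 'I_n -> R),
  P \is unitarymx /\ complexify M = udiag P (fun k => (d k)%:C).
Proof.
move=> M_sym; set A := complexify M.
have A_herm : A \is hermsymmx.
  apply/is_hermitianmxP; rewrite expr0 scale1r; apply/matrixP => x y.
  by rewrite !mxE -[in LHS]M_sym mxE conj_Creal ?complex_real.
exists (spectralmx A), (fun k => complex.Re (spectral_diag A 0 k)).
split; first exact: spectral_unitarymx.
rewrite {1}(hermsymmx_udiag A_herm); congr udiag; apply/funext => k.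
by rewrite RRe_real //; have /mxOverP := hermitian_spectral_diag_real A_herm.
Qed.

Variables (P : 'M[R[i]]_n) (d : 'I_n -> R).
Hypothesis P_unitary : P \is unitarymx.
Hypothesis ME : complexify M = udiag P (fun k => (d k)%:C).

Lemma transition_udiag t : transition M t = udiag P (fun k => cexp (t * d k)).
Proof.
rewrite /transition ME udiagZ.
have -> : (fun k => 'i * t%:C * (d k)%:C) =
    (fun k => 'i * (t * d k)%:C) :> ('I_n -> R[i]).
  by apply/funext => k; rewrite rmorphM mulrA.
by apply: expmx_udiag => // k; exact: cvg_cexp.
Qed.

Lemma eigenproj_udiag a : eigenproj M a = udiag P (fun k => (d k == a)%:R).
Proof.
have d_real k : (d k)%:C \is Num.real by rewrite complex_real.
have := proj_ortho_eigenspace_udiag P_unitary a%:C d_real.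
rewrite /eigenproj ME => projE.
transitivity (udiag P (fun k => ((d k)%:C == a%:C)%:R)); first by move: projE; apply.
by congr udiag; apply/funext => k; rewrite (inj_eq (@complexI R)).
Qed.

(** Multiplying by the invertible [P] makes the projection a coordinate selection. The values 1, -1
    and 0 of [c] serve for the plus part, the minus part and the support. *)
Lemma eigenproj_colP a x y (c : R[i]) :
  eigenproj M a *m unit_vec x = c *: (eigenproj M a *m unit_vec y) <->
  forall k, d k = a -> P k x = c * P k y.
Proof.
have PE z k : (P *m (eigenproj M a *m unit_vec z)) k 0 = (d k == a)%:R * P k z.
  by rewrite eigenproj_udiag (mul_udiag_col P_unitary) -colE mxE.
have PZ (z : 'cV[R[i]]_n) k : (P *m (c *: z)) k 0 = c * (P *m z) k 0.
  by rewrite -scalemxAr mxE.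
split=> [eq_xy k dk|Pxy].
  by have := PE x k; rewrite eq_xy PZ PE dk eqxx !mul1r => ->.
apply: (can_inj (mulKmx (unitarymx_unit P_unitary))).
apply/colP => k; rewrite PZ !PE.
by case: eqVneq => [/Pxy ->|_]; rewrite ?mul1r ?mul0r ?mulr0.
Qed.

Lemma eigenvalue_udiag k : eigenvalue M (d k).
Proof.
rewrite -(eigenvalue_map (real_complex R)); apply/eigenvalueP; exists (row k P).
  by rewrite -[map_mx _ M]/(complexify M) ME (mul_udiag_row P_unitary).
exact: row_unitary_neq0.
Qed.

(** Applying [M] multiplies this coordinate both by [d k] and by [a]. *)
Lemma udiag_mul (z : 'cV[R]_n) (a : R) k :
  M *m z = a *: z -> d k <> a -> (P *m map_mx (real_complex R) z) k 0 = 0.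
Proof.
move=> Mz dk; set z' := map_mx _ z.
have Mz' : complexify M *m z' = a%:C *: z' by rewrite -map_mxM Mz map_mxZ.
have := mul_udiag_col P_unitary (fun k => (d k)%:C) z' k.
have PZ : (P *m (a%:C *: z')) k 0 = a%:C * (P *m z') k 0 by rewrite -scalemxAr mxE.
rewrite -ME Mz' PZ => /eqP.
rewrite -subr_eq0 -mulrBl mulf_eq0 -rmorphB fmorph_eq0 subr_eq0.
by case/orP => /eqP; first by move/esym/dk.
Qed.

End SymmetricMatrix.

(** * Twin vertices and their common eigenvector *)

Section Twins.
Context {R : realType} {n : nat} (X : wgraph R n) (u v : 'I_n).
Hypothesis uv_twins : twins X u v.

Lemma mx_of_sym k : (mx_of X k)^T = mx_of X k.
Proof.
have A_sym : (adj_mx X)^T = adj_mx X by apply/matrixP => x y; rewrite !mxE weight_sym.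
by case: k => //=; rewrite /lap_mx linearB /= A_sym /deg_mx tr_diag_mx.
Qed.

(** Weight 0 encodes non-adjacency, so equal adjacency settles the case of no common neighbour. *)
Lemma twins_weight x : x != u -> x != v -> weight X u x = weight X v x.
Proof.
move=> xu xv; case: uv_twins => _ adj wt _.
have := adj x xu xv; rewrite /Defs.adjacent /= => adjE.
have [u0|u0] := eqVneq (weight X u x) 0.
  by move: adjE; rewrite u0 eqxx => /esym/negbFE/eqP ->.
by apply: wt; rewrite /Defs.adjacent //= -adjE.
Qed.

Lemma twins_deg : deg X u = deg X v.
Proof.
have [uv _ _ loop] := uv_twins.
rewrite /deg loop; congr (_ + _).
have vu : v != u by rewrite eq_sym.
rewrite (bigD1 u) // (bigD1 v) //= [RHS](bigD1 u) // [in RHS](bigD1 v) //=.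
rewrite loop (weight_sym X u v) addrCA; congr (_ + (_ + _)).
by apply: eq_bigr => x /andP[xu xv]; exact: twins_weight.
Qed.

Lemma twins_eigenvector k :
  let z := delta_mx u 0 - delta_mx v 0 : 'cV[R]_n in
  mx_of X k *m z = theta X k u v *: z.
Proof.
have [uv _ _ loop] := uv_twins.
have vu : v != u by rewrite eq_sym.
rewrite /= mulmxBr -!colE; apply/colP => x.
have other : x != u -> x != v -> weight X x u = weight X x v.
  by move=> xu xv; rewrite ![weight X x _]weight_sym twins_weight.
case: k; rewrite /= !mxE ?eqxx ?andbT.
all: (have [->|xu] := eqVneq x u; last have [->|xv] := eqVneq x v).
all: rewrite ?(negbTE uv) ?(negbTE vu) ?eqxx ?mulr1n ?mulr0n ?twins_deg.
all: rewrite ?loop ?(weight_sym X v u) ?other //; ring.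
Qed.

End Twins.

(** * The arithmetic condition and the characterization *)

(** For [th <> 0], dividing the relation by [th] shows that the integer in (a) must be [\sum_j l j];
    for [th = 0] the relation is the one in (b). *)
Lemma even_relationsP (R : realType) (r : nat) (lambda : 'I_r -> R) (th : R) :
  even_relations lambda th <->
  forall l : 'I_r -> int,
    (th <> 0 ->
     (exists m : int, ~~ (2 %| m)%Z /\
        th^-1 * (\sum_(j < r) (l j)%:~R * lambda j) = m%:~R) ->
     \sum_(j < r) (l j)%:~R * (1 - lambda j / th) <> 0) /\
    (th = 0 ->
     \sum_(j < r) (l j)%:~R * lambda j = 0 ->
     (2 %| \sum_(j < r) l j)%Z).
Proof.
have relE (l : 'I_r -> int) : \sum_j (l j)%:~R * (lambda j - th) =
    \sum_j (l j)%:~R * lambda j - (\sum_j l j)%:~R * th.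
  rewrite [X in _ - X * _]rmorph_sum mulr_suml -sumrB; apply: eq_bigr => j _.
  by rewrite mulrBr.
have quotE (l : 'I_r -> int) : \sum_j (l j)%:~R * (1 - lambda j / th) =
    (\sum_j l j)%:~R - th^-1 * \sum_j (l j)%:~R * lambda j.
  rewrite rmorph_sum mulr_sumr -sumrB; apply: eq_bigr => j _.
  by rewrite /=; ring.
split=> [even_rel l|cond l].
  have := even_rel l; rewrite relE quotE => {}even_rel; split.
    move=> /eqP th0 [m [m_odd mE]] /eqP; rewrite mE subr_eq0 eqr_int => /eqP NE.
    have : (2 %| \sum_j l j)%Z.
      apply: even_rel; rewrite NE -mE mulrC mulrA divff // mul1r subrr.
      by [].
    by rewrite NE (negbTE m_odd).
  by move=> th0 S0; apply: even_rel; rewrite S0 th0 mulr0 subrr.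
have [cond1 cond2] := cond l.
rewrite relE => /eqP; rewrite subr_eq0 => /eqP SE.
have [th0|/eqP th0] := eqVneq th 0.
  by apply: cond2 => //; rewrite SE th0 mulr0.
apply/negPn/negP => N_odd.
have S_quot : th^-1 * (\sum_j (l j)%:~R * lambda j) = (\sum_j l j)%:~R.
  by rewrite SE mulrCA mulVf ?mulr1 //; exact/eqP.
apply: (cond1 th0); first by exists (\sum_j l j).
by rewrite quotE S_quot subrr.
Qed.

Theorem theorem5p2 (R : realType) (n : nat) (X : wgraph R n) (k : graph_matrix)
    (u v : 'I_n) (r : nat) (lambda : 'I_r -> R) :
  connected_graph X ->
  twins X u v ->
  injective lambda ->
  (forall j : 'I_r, lambda j <> theta X k u v) ->
  eig_support (mx_of X k) u = [set theta X k u v] `|` range lambda ->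
  pretty_good_state_transfer (mx_of X k) u v <->
  [/\ strongly_cospectral (mx_of X k) u v,
      eig_support_plus (mx_of X k) u v = range lambda,
      eig_support_minus (mx_of X k) u v = [set theta X k u v]
    & forall l : 'I_r -> int,
        (theta X k u v <> 0 ->
         (exists m : int, ~~ (2 %| m)%Z /\
            (theta X k u v)^-1 * (\sum_(j < r) (l j)%:~R * lambda j) = m%:~R) ->
         \sum_(j < r) (l j)%:~R * (1 - lambda j / theta X k u v) <> 0) /\
        (theta X k u v = 0 ->
         \sum_(j < r) (l j)%:~R * lambda j = 0 ->
         (2 %| \sum_(j < r) l j)%Z)].
Proof.
move=> _ uv_twins lambda_inj lambda_neq suppE.
set M := mx_of X k in suppE *; set th := theta X k u v in lambda_neq suppE *.
have [P [d [P_unitary ME]]] := symmetric_udiag (mx_of_sym X k).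
have [uv _ _ _] := uv_twins.
pose p l := P l u; pose q l := P l v.
have p_unit : \sum_l (p l)^* * p l = 1 by rewrite sum_conj_mul // eqxx.
have q_unit : \sum_l (q l)^* * q l = 1 by rewrite sum_conj_mul // eqxx.
have pq_ortho : \sum_l (p l)^* * q l = 0 by rewrite sum_conj_mul // (negbTE uv).
(* [e_u - e_v] is an eigenvector for [th], so its coordinates [p l - q l] vanish off [th]. *)
have pq_eq l : d l <> th -> p l = q l.
  move=> dl; have := udiag_mul P_unitary ME (twins_eigenvector uv_twins k) dl.
  rewrite map_mxB !map_delta_mx mulmxBr -!colE !mxE => /eqP.
  by rewrite subr_eq0 => /eqP.
have eigE c a x y := eigenproj_colP P_unitary ME a x y c.
have plusE a : eigenproj M a *m unit_vec u = eigenproj M a *m unit_vec v <->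
    forall l, d l = a -> p l = q l.
  have := eigE 1 a u v; rewrite scale1r => ->.
  by split=> pq l dl; have := pq l dl; rewrite mul1r.
have minusE a : eigenproj M a *m unit_vec u = - (eigenproj M a *m unit_vec v) <->
    forall l, d l = a -> p l = - q l.
  have := eigE (-1) a u v; rewrite scaleN1r => ->.
  by split=> pq l dl; have := pq l dl; rewrite mulN1r.
have zeroE a : eigenproj M a *m unit_vec u = 0 <-> forall l, d l = a -> p l = 0.
  have := eigE 0 a u u; rewrite scale0r => ->.
  by split=> pq l dl; have := pq l dl; rewrite mul0r.
(* Both signs at once would give [p l = 0] throughout the eigenspace, contradicting membership in
   the support. *)
have supp_pm a : eig_support M u a -> (forall l, d l = a -> p l = q l) ->
    (forall l, d l = a -> p l = - q l) -> False.
  move=> [_ nz] pq pNq; apply: nz; apply/zeroE => l dl; apply/eqP.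
  by rewrite -[_ == _](mulrn_eq0 (p l) 2) mulr2n {1}(pq l dl) (pNq l dl) subrr.
have supp_th : eig_support M u th by rewrite suppE; left.
have p_supp l : p l != 0 -> d l = th \/ exists j, d l = lambda j.
  move=> pl; have : eig_support M u (d l).
    split; first exact: (eigenvalue_udiag P_unitary ME).
    by move/zeroE => /(_ l erefl); apply/eqP.
  by rewrite suppE => -[->|[j _ <-]]; [left | right; exists j].
have supp_lambda j : eig_support M u (lambda j) by rewrite suppE; right; exists j.
have supp_p j : exists2 l, d l = lambda j & p l != 0.
  apply: contrapT => no_l; have [_] := supp_lambda j; apply; apply/zeroE => l dl.
  by apply/eqP/negPn/negP => pl; apply: no_l; exists l.
have transferE : pretty_good_state_transfer M u v <->
    almost_transfer (mass p d lambda) lambda th.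
  have ampE t : transition M t u v = amplitude (mass p d lambda) lambda th t.
    rewrite (transition_udiag P_unitary ME) udiagE.
    exact: (overlap_amplitude pq_ortho pq_eq lambda_inj lambda_neq p_supp).
  by split=> tr eps /tr [t tP]; exists t; [rewrite -ampE | rewrite ampE].
have mass0 := mass_gt0 supp_p.
have W_le := mass_le p_unit q_unit pq_ortho pq_eq lambda_inj lambda_neq p_supp.
have halfE := mass_halfP p_unit q_unit pq_ortho pq_eq lambda_inj lambda_neq p_supp.
(* The columns already agree off [th], so condition (1) reduces to the opposite sign at [th]. *)
have cospectralE : (forall l, d l = th -> p l = - q l) <->
    [/\ strongly_cospectral M u v, eig_support_plus M u v = range lambda
      & eig_support_minus M u v = [set th]].
  split=> [pNq|[_ _ minus]]; last first.
    have : eig_support_minus M u v th by rewrite minus.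
    by case=> _ /minusE.
  split.
  - move=> a _; have [->|/eqP a_th] := eqVneq a th; [right | left].
      exact/minusE.
    by apply/plusE => l dl; apply: pq_eq; rewrite dl.
  - apply/seteqP; split=> a.
      move=> [a_supp /plusE pq]; move: (a_supp); rewrite suppE => -[ath|//].
      by move: ath a_supp pq => -> a_supp pq; case: (supp_pm _ a_supp pq pNq).
    move=> [j _ <-]; split; first exact: supp_lambda.
    by apply/plusE => l dl; apply: pq_eq; rewrite dl.
  - apply/seteqP; split=> a.
      move=> [a_supp /minusE pN]; move: (a_supp); rewrite suppE => -[//|[j _ ja]].
      case: (supp_pm _ a_supp _ pN) => l dl; apply: pq_eq.
      by rewrite dl -ja.
    by move=> ->; split; [exact: supp_th | apply/minusE].
rewrite transferE; split=> [transfer|[strong plus minus rel]].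
  have W12 : \sum_j mass p d lambda j = 2^-1.
    by apply/eqP; rewrite eq_le W_le (almost_transfer_mass_ge mass0 transfer).
  have /halfE/cospectralE[strong plus minus] := W12.
  split=> //; apply/even_relationsP.
  exact: (almost_transfer_even mass0 W12 transfer).
have /halfE W12 : forall l, d l = th -> p l = - q l by apply/cospectralE.
by apply: (even_almost_transfer mass0 W12); apply/even_relationsP.
Qed.
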